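(* Let $\mathcal{W}_n$ be the $n$-dimensional complex filiform Lie algebra with basis $\{e_1,\dots,e_n\}$ and brackets $$[e_i,e_j]=-[e_j,e_i]=(j-i)e_{i+j},\quad i+j\le n,$$ all other brackets of basis elements being zero. Then $\mathcal{W}_n$ is isomorphic to a subalgebra of $\mathfrak{gl}(n,\mathbb{C})$ via the linear map $\varphi:\mathcal{W}_n\to\mathfrak{gl}(n,\mathbb{C})$ given by $$\varphi(e_1)=\sum_{k=1}^{n-2}E_{k,k+1},\qquad \varphi(e_2)=\sum_{k=1}^{n-3}\frac{1}{n-k}E_{k,k+2}+E_{n-1,n},$$ $$\varphi(e_i)=\frac{1}{(i-2)!}\left(\sum_{k=1}^{n-i-1}\left(\sum_{s=0}^{i-2}\frac{(-1)^{i+s}\binom{i-2}{s}}{n-k-s}\right)E_{k,k+i}+E_{n+1-i,n}\right),\quad 3\le i\le n,$$ and this faithful representation is minimal.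
   Context: All Lie algebras and representations are finite-dimensional over $\mathbb{C}$. $\mathfrak{gl}(m,\mathbb{C})$ is the Lie algebra of complex $m\times m$ matrices with bracket $[A,B]=AB-BA$, and $E_{i,j}$ is the matrix whose $(i,j)$ entry is $1$ and whose other entries are $0$. Empty sums are zero. A representation of dimension $m$ of a Lie algebra $\mathfrak{g}$ is a Lie algebra homomorphism $\mathfrak{g}\to\mathfrak{gl}(m,\mathbb{C})$; it is faithful if it is injective. Set $\mu(\mathfrak{g})=\min\{\dim M \mid M \text{ is a faithful } \mathfrak{g}\text{-module}\}$; a faithful representation is called minimal if its dimension equals $\mu(\mathfrak{g})$. A Lie algebra $L$ of dimension $m$ is filiform if $\dim L^i=m-i$ for $2\le i\le m$, where $L^1=L$ and $L^{k+1}=[L,L^k]$.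
   Formalization: The formal statement assumes n ≥ 3; for n = 1 and n = 2 the given formula makes φ(e_1) = 0 (an empty sum), so φ is not faithful and the claim fails. *)

(* Defs.v *)
From HB Require Import structures.
From mathcomp Require Import all_boot all_order all_algebra.
From mathcomp Require Import boolp classical_sets reals complex.
From mathcomp Require Import ring lra zify.

Set Implicit Arguments.
Unset Strict Implicit.
Unset Printing Implicit Defensive.

Import GRing.Theory.
Local Open Scope ring_scope.

HB.mixin Record isLieAlgebra (K : fieldType) L of Vector K L := {
  lie_br : L -> L -> L;
  lie_brPl : forall (a : K) (x y z : L),
    lie_br (a *: x + y) z = a *: lie_br x z + lie_br y z;
  lie_brPr : forall (a : K) (x y z : L),
    lie_br z (a *: x + y) = a *: lie_br z x + lie_br z y;
  lie_brxx : forall x : L, lie_br x x = 0;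
  lie_jacobi : forall x y z : L,
    lie_br x (lie_br y z) + lie_br y (lie_br z x) + lie_br z (lie_br x y) = 0
}.

#[short(type="lieAlgType")]
HB.structure Definition LieAlgebra (K : fieldType) :=
  {L of isLieAlgebra K L & Vector K L}.

Section LieTheory.
Variable K : fieldType.
Implicit Types L : lieAlgType K.

Definition lie_hom L L' (f : 'Hom(L, L')) : Prop :=
  forall x y : L, f (lie_br x y) = lie_br (f x) (f y).

Definition lie_subalgebra L (U : {vspace L}) : Prop :=
  forall x y : L, x \in U -> y \in U -> lie_br x y \in U.

(* [U, V]; by bilinearity the brackets of basis elements suffice *)
Definition lie_prodv L (U V : {vspace L}) : {vspace L} :=
  <<[seq lie_br u v | u <- vbasis U, v <- vbasis V]>>%VS.

(* L^i for i >= 1; the value at i = 0 is irrelevant *)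
Definition lower_central L (i : nat) : {vspace L} :=
  iter i.-1 (lie_prodv fullv) fullv.

Definition filiform L : Prop :=
  forall i : nat, (2 <= i <= \dim {:L})%N ->
    \dim (lower_central L i) = (\dim {:L} - i)%N.

End LieTheory.

(* gl(m, K): an alias of the type of matrices, so that the Lie structure is not
   attached to all matrix types *)
Definition gl (K : fieldType) (m : nat) : Type := 'M[K]_m.

Section Gl.
Variables (K : fieldType) (m : nat).
HB.instance Definition _ := Vector.on (gl K m).

Definition gl_br (A B : gl K m) : gl K m := A *m B - B *m A.

Fact gl_brPl (a : K) (x y z : gl K m) :
  gl_br (a *: x + y) z = a *: gl_br x z + gl_br y z.
Proof.
rewrite /gl_br mulmxDl mulmxDr -scalemxAl -scalemxAr opprD scalerBr.
by rewrite addrACA.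
Qed.

Fact gl_brPr (a : K) (x y z : gl K m) :
  gl_br z (a *: x + y) = a *: gl_br z x + gl_br z y.
Proof.
rewrite /gl_br mulmxDl mulmxDr -scalemxAl -scalemxAr opprD scalerBr.
by rewrite addrACA.
Qed.

Fact gl_brxx (x : gl K m) : gl_br x x = 0.
Proof. exact: subrr. Qed.

Fact gl_jacobi (x y z : gl K m) :
  gl_br x (gl_br y z) + gl_br y (gl_br z x) + gl_br z (gl_br x y) = 0.
Proof.
rewrite /gl_br !mulmxBl !mulmxBr !mulmxA; apply/matrixP => i j; rewrite !mxE.
ring.
Qed.

HB.instance Definition _ :=
  isLieAlgebra.Build K (gl K m) gl_brPl gl_brPr gl_brxx gl_jacobi.
End Gl.

(* W_n, realised on K^n *)
Definition Witt (K : fieldType) (n : nat) : Type := 'rV[K]_n.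

Section Witt.
Variables (K : fieldType) (n : nat).
HB.instance Definition _ := Vector.on (Witt K n).

(* e_1, ..., e_n are the standard basis vectors (1-based); note that
   We i = 0 for i outside of {1, ..., n} *)
Definition We (i : nat) : Witt K n := \row_(j < n) (j.+1 == i)%:R.

Definition Witt_str (i j : nat) : Witt K n :=
  if (i + j <= n)%N then (j%:R - i%:R) *: We (i + j) else 0.

Definition Witt_br (x y : Witt K n) : Witt K n :=
  \sum_(i < n) \sum_(j < n)
    ((x : 'rV[K]_n) 0 i * (y : 'rV[K]_n) 0 j) *: Witt_str i.+1 j.+1.

Lemma Witt_coord (x : Witt K n) :
  x = \sum_(i < n) (x : 'rV[K]_n) 0 i *: We i.+1.
Proof.
apply/rowP => j; rewrite summxE (bigD1 j) //= !mxE eqxx mulr1.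
rewrite big1 ?addr0 // => i ij; rewrite !mxE eqSS.
by rewrite -(inj_eq val_inj) eq_sym in ij; rewrite (negbTE ij) mulr0.
Qed.

Fact Witt_brPl (a : K) (x y z : Witt K n) :
  Witt_br (a *: x + y) z = a *: Witt_br x z + Witt_br y z.
Proof.
rewrite /Witt_br scaler_sumr -big_split; apply: eq_bigr => i _ /=.
rewrite scaler_sumr -big_split; apply: eq_bigr => j _ /=.
by rewrite !mxE mulrDl scalerDl -mulrA scalerA.
Qed.

Fact Witt_brPr (a : K) (x y z : Witt K n) :
  Witt_br z (a *: x + y) = a *: Witt_br z x + Witt_br z y.
Proof.
rewrite /Witt_br scaler_sumr -big_split; apply: eq_bigr => i _ /=.
rewrite scaler_sumr -big_split; apply: eq_bigr => j _ /=.
by rewrite !mxE mulrDr scalerDl mulrCA scalerA.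
Qed.

Lemma Witt_str_anti (i j : nat) : Witt_str i j = - Witt_str j i.
Proof.
rewrite /Witt_str addnC; case: ifP => _; last by rewrite oppr0.
by rewrite -scaleNr opprB.
Qed.

Lemma Witt_strxx (i : nat) : Witt_str i i = 0.
Proof. by rewrite /Witt_str subrr scale0r if_same. Qed.

Fact Witt_brxx (x : Witt K n) : Witt_br x x = 0.
Proof.
pose F (i j : 'I_n) : Witt K n :=
  ((x : 'rV[K]_n) 0 i * (x : 'rV[K]_n) 0 j) *: Witt_str i.+1 j.+1.
have FN i j : F i j = - F j i by rewrite /F Witt_str_anti scalerN mulrC.
have Fxx i : F i i = 0 by rewrite /F Witt_strxx scaler0.
have split_sum : \sum_(i < n) \sum_(j < n) F i j =
    \sum_(i < n) \sum_(j < n | (i < j)%N) F i j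
    + \sum_(i < n) \sum_(j < n | (j < i)%N) F i j.
  rewrite -big_split; apply: eq_bigr => i _ /=.
  rewrite (bigID (fun j : 'I_n => (i < j)%N)) /=; congr (_ + _).
  rewrite (bigD1 i) ?ltnn //= Fxx add0r; apply: eq_bigl => j.
  by rewrite -leqNgt ltn_neqAle andbC.
rewrite /Witt_br split_sum.
rewrite [X in _ + X](exchange_big_dep predT) //= -big_split big1 // => i _.
by rewrite -big_split big1 // => j _ /=; rewrite FN addNr.
Qed.

Lemma Witt_br_anti (x y : Witt K n) : Witt_br x y = - Witt_br y x.
Proof.
apply/eqP; rewrite -addr_eq0; apply/eqP.
have := Witt_brxx (1 *: x + y).
by rewrite Witt_brPl !Witt_brPr !Witt_brxx !scale1r add0r addr0.
Qed.

Lemma Witt_br0r (x : Witt K n) : Witt_br x 0 = 0.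
Proof. by have /eqP := Witt_brPr (-1) x x x; rewrite !scaleN1r !addNr => /eqP. Qed.

Lemma Witt_brZr (a : K) (x y : Witt K n) : Witt_br x (a *: y) = a *: Witt_br x y.
Proof. by rewrite -[a *: y]addr0 Witt_brPr Witt_br0r addr0. Qed.

Lemma Witt_brE (i j : nat) : (0 < i <= n)%N -> (0 < j <= n)%N ->
  Witt_br (We i) (We j) = Witt_str i j.
Proof.
case: i j => [//|i] [//|j] /= lt_i lt_j.
rewrite /Witt_br (bigD1 (Ordinal lt_i)) //= (bigD1 (Ordinal lt_j)) //=.
rewrite !mxE !eqxx mulr1 scale1r !big1 ?addr0 // => k; rewrite -(inj_eq val_inj) => /= kN.
  by rewrite big1 // => l _; rewrite !mxE eqSS (negbTE kN) mul0r scale0r.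
by rewrite !mxE !eqSS (negbTE kN) mulr0 scale0r.
Qed.

Let J (x y z : Witt K n) :=
  Witt_br x (Witt_br y z) + Witt_br y (Witt_br z x) + Witt_br z (Witt_br x y).

Let JC x y z : J x y z = J y z x.
Proof. by rewrite /J -addrA addrC. Qed.

Let JP a x x' y z : J (a *: x + x') y z = a *: J x y z + J x' y z.
Proof.
rewrite /J !Witt_brPl !Witt_brPr !scalerDr.
by rewrite (addrACA (a *: _)) (addrACA (_ + _ : Witt K n)).
Qed.

Let Jstep y z : (forall i : 'I_n, J (We i.+1) y z = 0) -> forall x, J x y z = 0.
Proof.
move=> Je x; rewrite [x]Witt_coord.
elim/big_rec: _ => [|i u _ IH]; last by rewrite JP Je IH scaler0 addr0.
by have := JP (-1) 0 0 y z; rewrite scaler0 addr0 scaleN1r addNr.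
Qed.

Let Jbase (i j k : nat) : (0 < i <= n)%N -> (0 < j <= n)%N -> (0 < k <= n)%N ->
  Witt_br (We i) (Witt_br (We j) (We k)) =
  if (i + j + k <= n)%N then
    ((k%:R - j%:R) * (j%:R + k%:R - i%:R)) *: We (i + j + k) else 0.
Proof.
move=> hi hj hk; rewrite Witt_brE // /Witt_str.
case: ifP => [le_jk|gt_jk]; last first.
  by rewrite Witt_br0r ifF //; apply/negP => h; move/negP: gt_jk; apply; lia.
rewrite Witt_brZr Witt_brE //; last by lia.
rewrite /Witt_str addnA; case: ifP => _; last by rewrite scaler0.
by rewrite scalerA natrD.
Qed.

Fact Witt_jacobi (x y z : Witt K n) :
  Witt_br x (Witt_br y z) + Witt_br y (Witt_br z x) + Witt_br z (Witt_br x y)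
  = 0.
Proof.
rewrite -/(J x y z); move: x; apply: Jstep => i.
rewrite JC; move: y; apply: Jstep => j.
rewrite JC; move: z; apply: Jstep => k.
have [hi hj hk] : [/\ (0 < i.+1 <= n), (0 < j.+1 <= n) & (0 < k.+1 <= n)]%N.
  by rewrite !ltn_ord.
rewrite /J !Jbase //.
move: (i.+1) (j.+1) (k.+1) => a b c.
rewrite (_ : (a + b + c = c + a + b)%N); last by lia.
rewrite (_ : (b + c + a = c + a + b)%N); last by lia.
case: ifP => _; last by rewrite !addr0.
rewrite -!scalerDl; set t := (X in X *: _).
by have -> : t = 0; [rewrite /t; ring | rewrite scale0r].
Qed.

HB.instance Definition _ :=
  isLieAlgebra.Build K (Witt K n) Witt_brPl Witt_brPr Witt_brxx Witt_jacobi.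
End Witt.

Lemma Witt_lie_br (K : fieldType) (n i j : nat) :
  (0 < i <= n)%N -> (0 < j <= n)%N ->
  lie_br (We K n i) (We K n j) =
  if (i + j <= n)%N then (j%:R - i%:R) *: We K n (i + j) else 0.
Proof. exact: Witt_brE. Qed.

Lemma Witt_basis (K : fieldType) (n : nat) :
  basis_of {:Witt K n} [seq We K n i | i <- iota 1 n].
Proof.
rewrite basisEdim size_map size_iota dimvf /dim /= mul1n leqnn andbT.
apply/subvP => x _; rewrite [x]Witt_coord; apply: memv_suml => i _.
apply: memvZ; apply: memv_span; apply/mapP; exists i.+1 => //.
by rewrite mem_iota; apply/andP; split; rewrite ?add1n ?ltnS /=.
Qed.

Section Phi.
Variables (K : fieldType) (n : nat).

(* E_{i,j}, with 1-based i and j *)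
Definition Emx (i j : nat) : gl K n :=
  \matrix_(a < n, b < n) ((a.+1 == i) && (b.+1 == j))%:R.

(* The value prescribed for phi(e_i), 1 <= i <= n. All subtractions are in nat:
   for i = n the bound n - i - 1 is truncated to 0, which also gives the empty
   sum; every denominator n - k - s occurring is positive. *)
Definition phi_gen (i : nat) : gl K n :=
  if i == 1%N then \sum_(1 <= k < (n - 2).+1) Emx k k.+1
  else if i == 2%N then
    \sum_(1 <= k < (n - 3).+1) (n - k)%:R^-1 *: Emx k k.+2 + Emx n.-1 n
  else
    ((i - 2)`!%:R)^-1 *:
      (\sum_(1 <= k < (n - i - 1).+1)
          (\sum_(0 <= s < (i - 2).+1)
             (-1) ^+ (i + s) * 'C(i - 2, s)%:R / (n - k - s)%:R)
          *: Emx k (k + i)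
       + Emx (n + 1 - i) n).

Definition phi_fun (x : Witt K n) : gl K n :=
  \sum_(i < n) (x : 'rV[K]_n) 0 i *: phi_gen i.+1.

Fact phi_fun_linear : linear phi_fun.
Proof.
move=> a x y; rewrite /phi_fun scaler_sumr -big_split; apply: eq_bigr => i _ /=.
by rewrite !mxE scalerDl scalerA.
Qed.

HB.instance Definition _ :=
  GRing.isLinear.Build K (Witt K n) (gl K n) _ phi_fun phi_fun_linear.

Definition phi : 'Hom(Witt K n, gl K n) := linfun phi_fun.

Lemma phiE (i : nat) : (0 < i <= n)%N -> phi (We K n i) = phi_gen i.
Proof.
case: i => [//|i] /= lt_i.
rewrite lfunE /= /phi_fun (bigD1 (Ordinal lt_i)) //= big1 => [|j].
  by rewrite !mxE eqxx scale1r addr0.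
rewrite -(inj_eq val_inj) => /= ji.
by rewrite !mxE eqSS (negbTE ji) scale0r.
Qed.

End Phi.

Section Representations.
Variables (K : fieldType) (L : lieAlgType K).

Definition faithful_rep (m : nat) (f : 'Hom(L, gl K m)) : Prop :=
  lie_hom f /\ injective f.

Definition is_faithful_dim (m : nat) : Prop :=
  exists f : 'Hom(L, gl K m), faithful_rep f.

(* the least dimension of a faithful representation; the default 0 would only
   be used if there were none *)
Definition mu : nat :=
  xget 0%N [set m : nat | is_faithful_dim m /\
    forall k : nat, is_faithful_dim k -> (m <= k)%N]%classic.

Definition minimal_rep (m : nat) (f : 'Hom(L, gl K m)) : Prop :=
  faithful_rep f /\ m = mu.

End Representations.

(* Main.v *)
(* Conjugating by the diagonal matrix of the factorials [(n - k)!] turns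
   [phi e_i] into the matrix with entries [n - k - i + 1] at [(k, k + i)] for
   [k + i <= n - 1], and [i - 1] at [(n + 1 - i, n)], for which the bracket
   relations are immediate; the sums in [phi e_i] are the partial fraction
   expansions of [m! / (x (x - 1) ... (x - m))].

   For minimality, let [A_i] be the images of the [e_i] under a representation
   of dimension [m]. In an irreducible representation the last nonzero [A_k] is
   a scalar; for [k >= 3] it is also a commutator, so its trace vanishes. Hence
   [A_1] and [A_2] commute, are scalars too, and every representation can be made
   lower triangular. There, by induction on [a - b], the [(a, b)] entry of [A_i]
   vanishes for [i >= max (a - b + 2, 3)]: [[A_1, A_i]] has [(a, b)] entry
   [(A_1 a a - A_1 b b) * A_i a b], so either these diagonal entries differ and
   the entry dies because [A_(n+1) = 0], or it is zero for a commutator with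
   [A_1]. If [m < n] this gives [A_n = 0], so the representation is not
   faithful. *)

Require Import Defs.
From HB Require Import structures.
From mathcomp Require Import all_boot all_order all_algebra.
From mathcomp Require Import boolp classical_sets reals complex.
From mathcomp Require Import ring zify.

Set Implicit Arguments.
Unset Strict Implicit.
Unset Printing Implicit Defensive.

Import GRing.Theory Num.Theory.
Local Open Scope ring_scope.
Local Open Scope complex_scope.

(** * Representations of the Witt relations *)

Section WittFamily.
Variable K : numClosedFieldType.

(** Images of the [e_i] under a representation, continued by zero beyond [n], so that the bracket
    relation needs no case distinction on [i + j <= n]. The value [A 0] is unconstrained. *)
Definition witt_family (n m : nat) (A : nat -> 'M[K]_m) : Prop :=
  (forall i, (n < i)%N -> A i = 0) /\
  (forall i j, (0 < i)%N -> (0 < j)%N ->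
     A i *m A j - A j *m A i = (j%:R - i%:R) *: A (i + j)%N).

(** The hypothesis lets [Y *m X] be dropped between two factors, so products of compressions are
    compressions of products. Serves restrictions, quotients and changes of basis. *)
Lemma witt_family_compress n m k (A : nat -> 'M[K]_m)
    (X : 'M_(k, m)) (Y : 'M_(m, k)) :
  (forall i j, (0 < i)%N -> (0 < j)%N ->
     X *m A i *m Y *m (X *m A j *m Y) = X *m A i *m A j *m Y) ->
  witt_family n A -> witt_family n (fun i => X *m A i *m Y).
Proof.
move=> XAY [A0 AA]; split=> [i /A0 ->|i j i0 j0]; first by rewrite mulmx0 mul0mx.
rewrite !XAY // -mulmxBl -!(mulmxA X) -mulmxBr AA //.
by rewrite -scalemxAr -scalemxAl mulmxA.
Qed.

Lemma witt_family_sub n m r (A : nat -> 'M[K]_m)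
    (U : 'M_(r, m)) (X : 'M_(m, r)) :
  U *m X = 1%:M -> (forall i, (0 < i)%N -> exists D, U *m A i = D *m U) ->
  witt_family n A -> witt_family n (fun i => U *m A i *m X).
Proof.
move=> UX UA; apply: witt_family_compress => i j i0 _; have [D DE] := UA i i0.
by rewrite DE -(mulmxA D) UX mulmx1 !mulmxA.
Qed.

(** Action on the quotient by the row space of [U], in the basis given by [V]. As
    [U *m A j *m Y = 0], the part [X *m U] of the identity contributes nothing to products. *)
Lemma witt_family_quo n m r s (A : nat -> 'M[K]_m)
    (U : 'M_(r, m)) (V : 'M_(s, m)) (X : 'M_(m, r)) (Y : 'M_(m, s)) :
  U *m Y = 0 -> V *m Y = 1%:M -> X *m U + Y *m V = 1%:M ->
  (forall i, (0 < i)%N -> exists D, U *m A i = D *m U) ->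
  witt_family n A -> witt_family n (fun i => V *m A i *m Y).
Proof.
move=> UY VY XUYV UA; apply: witt_family_compress => i j _ j0.
have [D DE] := UA j j0.
have YV : Y *m V = 1%:M - X *m U by rewrite -XUYV addrC addKr.
rewrite !mulmxA -(mulmxA _ Y V) YV mulmxBr mulmx1 !mulmxBl.
have -> : V *m A i *m (X *m U) *m A j *m Y = 0.
  by rewrite -!mulmxA (mulmxA U) DE -!mulmxA UY !mulmx0.
by rewrite subr0.
Qed.

Lemma witt_family_gen n m (A : nat -> 'M[K]_m) i : witt_family n A ->
  (3 <= i)%N -> (i - 2)%:R *: A i = A 1%N *m A i.-1 - A i.-1 *m A 1%N.
Proof.
case=> _ AA i3; rewrite AA //; last by lia.
by rewrite -natrB; [congr (_%:R *: A _); lia | lia].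
Qed.

(** * Simultaneous triangularization *)

(* [k = m] is forced; leaving [k] free avoids casts between [r + s] and [m] when
   blocks are assembled. *)
Definition cotrig m (A : nat -> 'M[K]_m) : Prop :=
  exists (k : nat) (P : 'M_(k, m)) (Q : 'M_(m, k)),
    [/\ P *m Q = 1%:M, Q *m P = 1%:M &
        forall i, (0 < i)%N -> is_trig_mx (P *m A i *m Q)].

(** In the basis of the rows of [U] and [V] each [A i] is block lower triangular, so the bases
    triangularizing the two diagonal blocks can be stacked. *)
Lemma cotrig_block m r s (A : nat -> 'M[K]_m)
    (U : 'M_(r, m)) (V : 'M_(s, m)) (X : 'M_(m, r)) (Y : 'M_(m, s)) :
  U *m X = 1%:M -> U *m Y = 0 -> V *m X = 0 -> V *m Y = 1%:M ->
  X *m U + Y *m V = 1%:M ->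
  (forall i, (0 < i)%N -> U *m A i *m Y = 0) ->
  cotrig (fun i => U *m A i *m X) -> cotrig (fun i => V *m A i *m Y) -> cotrig A.
Proof.
move=> UX UY VX VY XUYV UAY [k [P [Q [PQ QP T]]]] [l [P' [Q' [PQ' QP' T']]]].
exists (k + l)%N, (col_mx (P *m U) (P' *m V)), (row_mx (X *m Q) (Y *m Q')).
split.
- rewrite mul_col_row !mulmxA -![_ *m U *m _]mulmxA -![_ *m V *m _]mulmxA.
  by rewrite UX UY VX VY !mulmx0 !mulmx1 !mul0mx PQ PQ' -scalar_mx_block.
- rewrite mul_row_col !mulmxA -(mulmxA X) -(mulmxA Y) QP QP'.
  by rewrite !mulmx1.
move=> i i0; rewrite mul_col_mx mul_col_row is_trig_block_mx //.
rewrite !mulmxA -(mulmxA P U) -(mulmxA P (U *m A i) Y) UAY //.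
rewrite mulmx0 mul0mx eqxx /=.
have := T i i0; have := T' i i0; rewrite !mulmxA => -> ->.
by [].
Qed.

Lemma witt_family_irreducible n m (A : nat -> 'M[K]_m) : (0 < m)%N ->
  witt_family n A ->
  (forall U : 'M_m, (forall i, (0 < i)%N -> stablemx U (A i)) ->
     U = 0 \/ row_full U) ->
  forall i, (0 < i)%N -> is_scalar_mx (A i).
Proof.
move=> m0 [A0 AA] irr.
(* Schur's lemma: an eigenspace of [A i] is nonzero and stable under all matrices commuting with
   [A i], hence full. *)
have central i : (forall j, (0 < j)%N -> comm_mx (A i) (A j)) ->
    is_scalar_mx (A i).
  move=> cA; have [a ea] := eigenvalue_closed (A i) m0.
  have [j j0||/row_fullP[B BE]] := irr (eigenspace (A i) a).
  - by apply/eigenspaceP; rewrite -mulmxA -cA // mulmxA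
      (eigenspaceP (submx_refl _)) -scalemxAl.
  - by move=> E; rewrite /eigenvalue E eqxx in ea.
  - apply/is_scalar_mxP; exists a.
    by rewrite -[A i]mul1mx -BE -mulmxA (eigenspaceP (submx_refl _))
      -scalemxAr BE scalemx1.
(* Descending induction on [i]: once all higher members vanish, [A i] is central, hence a scalar
   [a]. As a commutator it has trace zero, so [m * a = 0]. *)
have top i : (3 <= i)%N -> A i = 0.
  have [k] := ubnP (n.+1 - i)%N.
  elim: k i => [|k IH] i; first by lia.
  move=> ik i3; have [/A0 //|ni] := ltnP n i.
  have /is_scalar_mxP[a Aa] : is_scalar_mx (A i).
    apply: central => j j0; apply/eqP; rewrite -subr_eq0 AA //; last by lia.
    by rewrite IH ?scaler0 //; lia.
  have := congr1 (@mxtrace _ _) (witt_family_gen (conj A0 AA) i3).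
  rewrite raddfB /= mxtrace_mulC subrr Aa mxtraceZ mxtrace_scalar => /eqP.
  rewrite mulf_eq0 pnatr_eq0 -mulr_natl mulf_eq0 pnatr_eq0.
  have -> : (i - 2 == 0)%N = false by apply/negbTE; lia.
  have -> : (m == 0)%N = false by apply/negbTE; lia.
  by move=> /eqP ->; exact: raddf0.
(* Distinct positive [i] and [j] have [i + j >= 3], so [top] kills the commutator. *)
move=> i i0; apply: central => j j0; apply/eqP; rewrite -subr_eq0 AA //.
have [->|/eqP ij] := altP (i =P j); first by rewrite subrr scale0r.
by rewrite top ?scaler0 //; lia.
Qed.

Lemma witt_family_cotrig n m (A : nat -> 'M[K]_m) :
  witt_family n A -> cotrig A.
Proof.
have [N] := ubnP m; elim: N m A => [//|N IH] m A mN AW.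
have [m0|m0] := posnP m.
  subst m; exists 0%N, 1%:M, 1%:M; split; rewrite ?mul1mx // => i _.
  by apply/is_trig_mxP => -[].
have [irr|] := pselect (forall U : 'M_m,
    (forall i, (0 < i)%N -> stablemx U (A i)) -> U = 0 \/ row_full U).
  exists m, 1%:M, 1%:M; split; rewrite ?mul1mx // => i i0.
  have /is_scalar_mxP[a ->] := witt_family_irreducible m0 AW irr i0.
  by rewrite mul1mx mulmx1 scalar_mx_is_trig.
move=> /existsNP[U /not_implyP[stab /not_orP[/eqP U0 Ufull]]].
have r_s : (\rank U + \rank U^C = m)%N.
  by rewrite mxrank_compl subnKC // rank_leq_col.
(* [P] is invertible, but its number of rows equals [m] only propositionally, hence the
   pseudo-inverse. The halves of [pinvmx P] are the dual [X] and [Y]. *)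
pose P := col_mx (row_base U) (row_base U^C%MS).
have Pfull : row_full P.
  rewrite -sub1mx -addsmxE.
  rewrite (adds_eqmx (eq_row_base U) (eq_row_base _)) sub1mx.
  exact: addsmx_compl_full.
have Pfree : row_free P.
  by rewrite /row_free; move: Pfull; rewrite /row_full => /eqP ->; rewrite r_s.
have := mulmxVp Pfree; have := mulVpmx Pfull.
rewrite -(hsubmxK (pinvmx P)) mul_row_col mul_col_row scalar_mx_block.
set X := lsubmx _; set Y := rsubmx _ => XUYV /eq_block_mx[UX UY VX VY].
have UAX i : (0 < i)%N ->
    exists D, row_base U *m A i = D *m row_base U.
  by move=> i0; apply/submxP; rewrite stablemx_row_base stab.
have r0 : (0 < \rank U)%N by rewrite lt0n mxrank_eq0.
have rm : (\rank U < m)%N.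
  by rewrite ltn_neqAle rank_leq_col andbT; apply/eqP => /eqP.
apply: (cotrig_block UX UY VX VY XUYV).
- by move=> i i0; have [D ->] := UAX i i0; rewrite -mulmxA UY mulmx0.
- by apply: IH; [lia | apply: witt_family_sub UX UAX AW].
- by apply: IH; [lia | apply: witt_family_quo UY VY XUYV UAX AW].
Qed.

(** * Vanishing entries of a lower triangular family *)

Lemma trig_comm_coef k (X Y : 'M[K]_k) (a b : 'I_k) :
  is_trig_mx X ->
  (forall c : 'I_k, (c < a)%N -> Y c b = 0) ->
  (forall c : 'I_k, (b < c)%N -> Y a c = 0) ->
  (X *m Y - Y *m X) a b = (X a a - X b b) * Y a b.
Proof.
(* In the terms [X a c * Y c b], triangularity kills [c > a] and [Yb] kills [c < a]; likewise only
   [c = b] survives in the other product. *)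
move=> /is_trig_mxP TX Yb Ya; rewrite !mxE (bigD1 a) //= big1 => [|c ca].
  rewrite (bigD1 b) //= big1 => [|c cb]; first by rewrite !addr0 mulrBl (mulrC (Y a b)).
  have [bc|bc|/val_inj E] := ltngtP b c; last by rewrite E eqxx in cb.
  - by rewrite Ya ?mul0r.
  - by rewrite TX ?mulr0.
have [ac|ac|/val_inj E] := ltngtP a c; last by rewrite E eqxx in ca.
- by rewrite TX ?mul0r.
- by rewrite Yb ?mulr0.
Qed.

Lemma witt_family_trig_coef n k (B : nat -> 'M[K]_k) :
  witt_family n B -> (forall i, (0 < i)%N -> is_trig_mx (B i)) ->
  forall i (a b : 'I_k), (3 <= i)%N -> (a + 2 <= b + i)%N -> B i a b = 0.
Proof.
move=> BW BT i a b; have [d] := ubnP (a - b)%N.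
elim: d i a b => [//|d IH] i a b dab i3 iab.
have [ab|ba] := ltnP a b; first by have /is_trig_mxP-> := BT i ltac:(lia).
(* A strictly smaller index difference gains one, so [a + 1 <= b + j] suffices here; this lets [rec]
   be used with [l = i - 1]. *)
have small j (c e : 'I_k) : (3 <= j)%N -> (a + 1 <= b + j)%N ->
    (c + b < a + e)%N -> B j c e = 0.
  move=> j3 jab ce; have [lt_ce|le_ec] := ltnP c e.
    by have /is_trig_mxP-> := BT j ltac:(lia).
  by apply: IH; lia.
have rec j l : (0 < j)%N -> (3 <= l)%N -> (a + 1 <= b + l)%N ->
    (l%:R - j%:R) * B (j + l)%N a b = (B j a a - B j b b) * B l a b.
  move=> j0 l3 lab; rewrite -trig_comm_coef ?BT // => [|c ca|c bc].
  - by case: BW => _ ->; rewrite ?mxE //; lia.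
  - by apply: small; lia.
  - by apply: small; lia.
have natB0 (p q : nat) : (q < p)%N -> p%:R - q%:R != 0 :> K.
  by move=> qp; rewrite -natrB ?pnatr_eq0; lia.
have [lab|lab] := eqVneq (B 1%N a a) (B 1%N b b); last first.
  (* Distinct diagonal entries of [B 1]: by [rec], [B i a b] is a multiple of [B (1 + i) a b], and
     the members beyond [n] are zero. *)
  have [N] := ubnP (n.+1 - i)%N.
  elim: N i i3 iab => [|N IHN] i i3 iab iN; first by lia.
  have [ni|ni] := ltnP n i; first by case: BW => ->; rewrite ?mxE.
  have /esym/eqP := rec 1%N i isT i3 ltac:(lia).
  rewrite (IHN (1 + i)%N) ?mulr0; try lia.
  by rewrite mulf_eq0 subr_eq0 (negbTE lab) => /eqP.
have [i4|] := ltnP 3 i.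
  have /eqP := rec 1%N i.-1 isT ltac:(lia) ltac:(lia).
  rewrite lab subrr mul0r mulf_eq0 (negbTE (natB0 _ _ _)); last by lia.
  by rewrite add1n prednK; [move/eqP|lia].
(* For [i = 3] the relation [B 3 = [B 1, B 2]] is out of reach of [rec], which needs [l >= 3].
   Instead [[B 2, B 3] = B 5], whose entry is zero, forces [B 3 a b = 0] or equal diagonal entries
   of [B 2]. *)
move=> le_i3; have {i3 iab le_i3} [-> ab1] : i = 3%N /\ (a <= b + 1)%N by lia.
have B4 : B 4%N a b = 0.
  have /eqP := rec 1%N 3%N isT isT ltac:(lia).
  by rewrite lab subrr mul0r mulf_eq0 (negbTE (natB0 _ _ _)) // => /eqP.
have B5 : B 5%N a b = 0.
  have /eqP := rec 1%N 4%N isT isT ltac:(lia).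
  by rewrite B4 mulr0 mulf_eq0 (negbTE (natB0 _ _ _)) // => /eqP.
have /eqP := rec 2%N 3%N isT isT ltac:(lia).
rewrite B5 mulr0 eq_sym mulf_eq0 subr_eq0 => /predU1P[mab|/eqP//].
(* [Y] vanishes at [(a, a)] and [(b, b)], as [trig_comm_coef] requires when
   [b = a - 1]. *)
pose Y := B 2%N - (B 2%N b b)%:M.
have Y0 (c : 'I_k) : Y c c = B 2%N c c - B 2%N b b by rewrite !mxE eqxx mulr1n.
have YT (c e : 'I_k) : (c < e)%N -> Y c e = 0.
  move=> ce; rewrite !mxE -(inj_eq val_inj) (ltn_eqF ce) subr0.
  by have /is_trig_mxP-> := BT 2%N isT.
have := witt_family_gen BW (isT : 3 <= 3)%N; rewrite scale1r => ->.
have -> : B 1%N *m B 2%N - B 2%N *m B 1%N = B 1%N *m Y - Y *m B 1%N.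
  by rewrite mulmxBr mulmxBl scalar_mxC opprB addrA subrK.
have Yd (c e : 'I_k) : (c + b < a + e)%N -> c = e \/ (c < e)%N.
  by move=> ce; have [|] := ltnP c e; [right | left; apply: val_inj => /=; lia].
rewrite trig_comm_coef ?BT //; first by rewrite lab subrr mul0r.
- move=> c ca; have [->|] := Yd c b ltac:(lia); last exact: YT.
  by rewrite Y0 subrr.
- move=> c bc; have [<-|] := Yd a c ltac:(lia); last exact: YT.
  by rewrite Y0 mab subrr.
Qed.

Lemma witt_family_last0 n m (A : nat -> 'M[K]_m) :
  witt_family n A -> (3 <= n)%N -> (m < n)%N -> A n = 0.
Proof.
move=> AW n3 mn; have [k [P [Q [PQ QP T]]]] := witt_family_cotrig AW.
have km : (k <= m)%N.
  by rewrite -(mxrank1 K k) -PQ (leq_trans (mxrankM_maxl _ _)) ?rank_leq_col.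
have BW : witt_family n (fun i => P *m A i *m Q).
  apply: witt_family_compress AW => i j _ _.
  by rewrite !mulmxA -(mulmxA _ Q P) QP mulmx1.
have B0 : P *m A n *m Q = 0.
  (* The bound [a + 2 <= b + n] holds at every entry because [a < k <= m < n]. *)
  apply/matrixP => a b; rewrite [RHS]mxE; apply: (witt_family_trig_coef BW T) => //.
  by have := ltn_ord a; lia.
have : Q *m (P *m A n *m Q) *m P = 0 by rewrite B0 mulmx0 mul0mx.
by rewrite !mulmxA QP mul1mx -mulmxA QP mulmx1.
Qed.

End WittFamily.

(** * The representation phi *)

Lemma fact_natr_neq0 (K : numFieldType) (p : nat) : p`!%:R != 0 :> K.
Proof. by rewrite pnatr_eq0 -lt0n fact_gt0. Qed.

(* [1 / (x (x - 1) ... (x - m))] has residue [(-1)^(m-s) / (s! (m-s)!)] at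
   [x = s]. *)
Lemma binomial_partial_fractions (K : numFieldType) (m x : nat) : (m < x)%N ->
  \sum_(0 <= s < m.+1) (-1) ^+ (m + s) * 'C(m, s)%:R / (x - s)%:R =
  m`!%:R * (x - m.+1)`!%:R / x`!%:R :> K.
Proof.
elim: m x => [|m IH] [//|x] mx.
  rewrite big_nat1 !subn0 bin0 expr0 !mul1r subn1 factS natrM invfM mulrCA.
  by rewrite divff ?fact_natr_neq0 ?mulr1.
(* Pascal's rule: writing [S m x] for the sum, [S (m + 1) (x + 1) = S m x - S m (x + 1)]. *)
have -> : \sum_(0 <= s < m.+2) (-1) ^+ (m.+1 + s) * 'C(m.+1, s)%:R / (x.+1 - s)%:R
  = \sum_(0 <= s < m.+1) (-1) ^+ (m + s) * 'C(m, s)%:R / (x - s)%:R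
    - \sum_(0 <= s < m.+1) (-1) ^+ (m + s) * 'C(m, s)%:R / (x.+1 - s)%:R :> K.
  have -> : \sum_(0 <= s < m.+1) (-1) ^+ (m + s) * 'C(m, s)%:R / (x.+1 - s)%:R
    = \sum_(0 <= s < m.+2) (-1) ^+ (m + s) * 'C(m, s)%:R / (x.+1 - s)%:R :> K.
    by rewrite [RHS]big_nat_recr //= bin_small // mulr0 mul0r addr0.
  rewrite big_nat_recl // [X in _ - X]big_nat_recl // !bin0 opprD addrCA.
  rewrite -sumrB !addn0 exprS mulN1r !mulNr; congr (_ + _).
  apply: eq_bigr => s _; rewrite subSS binS natrD addSn addnS !exprS.
  by rewrite !mulN1r opprK !mulNr opprK -mulrDl -mulrDr addrC.
rewrite !IH ?(ltnW mx) //.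
have -> : (x.+1 - m.+2 = x - m.+1)%N by [].
have -> : (x.+1 - m.+1)%N = (x - m.+1).+1 by lia.
have x0 : x.+1%:R != 0 :> K by rewrite pnatr_eq0.
have fx := fact_natr_neq0 K x.
have -> : (x - m.+1).+1`!%:R = (x.+1%:R - m.+1%:R) * (x - m.+1)`!%:R :> K.
  by rewrite factS natrM -natrB; [congr (_%:R * _); lia | lia].
rewrite !factS !natrM; move: x0 fx.
move: (x.+1%:R) (x`!%:R) (m.+1%:R) (m`!%:R) ((x - m.+1)`!%:R) => X Fx M Fm F.
by move=> X0 Fx0; field; rewrite X0 Fx0.
Qed.

(** * Closed form of the prescribed matrices and their bracket relations *)

Section Phi.
Variables (K : numFieldType) (n : nat).
Implicit Types i j : nat.

Lemma sum_EmxE (f : nat -> K) (N i : nat) (a b : 'I_n) :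
  (\sum_(1 <= k < N.+1) f k *: Emx K n k (k + i)) a b =
  ((a < N) && (b == a + i :> nat))%N%:R * f a.+1.
Proof.
rewrite big_add1 /= big_mkord summxE.
have [aN|aN] := ltnP a N; last first.
  rewrite mul0r big1 // => k _; rewrite !mxE eqSS.
  have -> : (a == k :> nat)%N = false by have := ltn_ord k; lia.
  by rewrite mulr0.
rewrite (bigD1 (Ordinal aN)) //= big1 => [|k ka].
  by rewrite !mxE eqxx addSn eqSS addr0 mulrC.
have ak : (a == k :> nat)%N = false.
  by apply/negbTE; apply: contra ka => /eqP E; apply/eqP/val_inj.
by rewrite !mxE eqSS ak mulr0.
Qed.

(** The formula prescribed for [i >= 3] also covers [i = 2], leaving [i = 1] as the only special
    case. *)
Lemma phi_gen2 i : (2 <= i)%N ->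
  phi_gen K n i =
    ((i - 2)`!%:R)^-1 *:
      (\sum_(1 <= k < (n - i - 1).+1)
          (\sum_(0 <= s < (i - 2).+1)
             (-1) ^+ (i + s) * 'C(i - 2, s)%:R / (n - k - s)%:R)
          *: Emx K n k (k + i)
       + Emx K n (n + 1 - i) n).
Proof.
case: i => [//|[//|[_|//]]]; rewrite /phi_gen /= subnn fact0 invr1 scale1r.
have -> : (n - 2 - 1 = n - 3)%N by lia.
have -> : (n + 1 - 2 = n.-1)%N by lia.
congr (_ + _).
apply: eq_bigr => k _; rewrite big_nat1 subn0 bin0 addn0 addn2.
by rewrite sqrrN expr1n !mul1r.
Qed.

(** The quotient in the last column is [1 / (i - 2)!] for [i >= 2] and [0] for [i = 1], so one
    formula covers all [i]. The other columns come from the partial fraction identity. *)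
Lemma phi_genE i (a b : 'I_n) : (0 < i)%N ->
  phi_gen K n i a b =
    if (b < n.-1)%N then
      (b == a + i :> nat)%N%:R * ((n - a - i)`!%:R / (n - a).-1`!%:R)
    else (a + i == n)%N%:R * (i.-1%:R / i.-1`!%:R).
Proof.
have := ltn_ord a; have := ltn_ord b => bn an.
case: i => [//|[_|m _]].
  rewrite /phi_gen /=.
  under eq_bigr => k _ do rewrite -[Emx K n _ _]scale1r -addn1.
  rewrite sum_EmxE mulr1 mul0r mulr0 subn1 divff ?fact_natr_neq0 // mulr1.
  case: ifP => bn1; first by congr (nat_of_bool _)%:R; lia.
  by have -> : ((a < n - 2) && (b == a + 1 :> nat))%N = false by lia.
rewrite phi_gen2 // mxE [X in _ * X]mxE sum_EmxE mxE subSS subSS subn0 /=.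
rewrite factS natrM.
have m0 := fact_natr_neq0 K m; have Sm0 : m.+1%:R != 0 :> K by rewrite pnatr_eq0.
case: ifP => bn1.
  have -> : (b.+1 == n)%N = false by lia.
  rewrite andbF addr0.
  case: eqP => E; last by rewrite andbF !mul0r mulr0.
  have -> : (a < n - m.+2 - 1)%N by lia.
  rewrite !mul1r; under eq_bigr => s _ do rewrite !addSn !exprS !mulN1r opprK.
  rewrite binomial_partial_fractions; last by lia.
  have -> : (n - a.+1 - m.+1 = n - a - m.+2)%N by lia.
  have -> : (n - a.+1 = (n - a).-1)%N by lia.
  by rewrite !mulrA mulVf // mul1r.
have -> : (a < n - m.+2 - 1)%N && (b == a + m.+2 :> nat)%N = false by lia.
have -> : (b.+1 == n)%N by lia.
rewrite mul0r add0r andbT.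
have -> : (a.+1 == n + 1 - m.+2)%N = (a + m.+2 == n)%N by lia.
by rewrite mulrC; congr (_ * _); rewrite invfM mulrA divff ?mul1r.
Qed.

(** Indices are 0-based: [n - a - i] is [n - k - i + 1] for [k = a + 1]. The last-column entry sits
    one row below the [i]-th superdiagonal. *)
Definition unscaled_phi i : 'M[K]_n := \matrix_(a, b)
  if (b < n.-1)%N then (b == a + i :> nat)%N%:R * (n - a - i)%:R
  else (a + i == n)%N%:R * i.-1%:R.

Definition fact_diag : 'rV[K]_n := \row_a (n - a).-1`!%:R.

Lemma phi_gen_diag i : (0 < i)%N ->
  phi_gen K n i =
  diag_mx (map_mx GRing.inv fact_diag) *m unscaled_phi i *m diag_mx fact_diag.
Proof.
move=> i0; apply/matrixP => a b; rewrite phi_genE // mul_mx_diag mul_diag_mx !mxE.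
have [bn|bn] := ltnP b n.-1.
  case: eqP => [E|]; last by rewrite !(mul0r, mulr0).
  rewrite !mul1r mulrC -mulrA; congr (_ * _).
  have -> : (n - a - i = (n - b).-1.+1)%N by lia.
  by rewrite factS natrM.
case: eqP => [E|]; last by rewrite !(mul0r, mulr0).
have -> : (n - b).-1 = 0%N by have := ltn_ord b; lia.
have -> : (n - a).-1 = i.-1 by lia.
by rewrite mulr1 !mul1r mulrC.
Qed.

Lemma unscaled_phi_br i j : (0 < i)%N -> (0 < j)%N ->
  unscaled_phi i *m unscaled_phi j - unscaled_phi j *m unscaled_phi i =
  (j%:R - i%:R) *: unscaled_phi (i + j).
Proof.
have mulE i' j' (a b : 'I_n) : (0 < i')%N -> (0 < j')%N ->
    (unscaled_phi i' *m unscaled_phi j') a b =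
    if (b < n.-1)%N
    then (b == a + i' + j' :> nat)%N%:R * ((n - a - i')%:R * (n - a - i' - j')%:R)
    else (a + i' + j' == n)%N%:R * ((n - a - i')%:R * j'.-1%:R).
  move=> i0 j0; rewrite mxE.
  have [lt|ge] := ltnP (a + i') n.-1.
    have ai : (a + i' < n)%N by lia.
    rewrite (bigD1 (Ordinal ai)) //= big1 => [|c ca]; rewrite !mxE /=.
      rewrite lt eqxx mul1r addr0; case: ifP => _; last by rewrite mulrCA.
      by rewrite subnDA mulrCA.
    have cai : (c == a + i' :> nat)%N = false.
      by apply/negbTE; apply: contra ca => /eqP E; apply/eqP/val_inj.
    have ain : (a + i' == n)%N = false by lia.
    by rewrite cai ain !mul0r if_same mul0r.
  (* Now [a + i' >= n - 1]. A contribution could only come from the last column with [j' = 1], where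
     the factor [j'.-1] is zero. *)
  rewrite big1 => [|c _].
    case: ifP => bn.
      have -> : (b == a + i' + j' :> nat)%N = false by lia.
      by rewrite mul0r.
    case: eqP => E; last by rewrite mul0r.
    have -> : j' = 1%N by lia.
    by rewrite !mulr0.
  rewrite !mxE; have := ltn_ord c; have := ltn_ord b => bn cn.
  case: ifP => cn1.
    have -> : (c == a + i' :> nat)%N = false by lia.
      by rewrite !mul0r.
  case: ifP => bn1.
    have -> : (b == c + j' :> nat)%N = false by lia.
      by rewrite mul0r mulr0.
  case: (eqVneq (c + j')%N n) => E; last by rewrite mul0r mulr0.
  have -> : j' = 1%N by lia.
  by rewrite !mulr0.
move=> i0 j0; apply/matrixP => a b; rewrite !mxE.
have := mulE i j a b i0 j0; have := mulE j i a b j0 i0; rewrite !mxE => -> ->.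
have [bn|bn] := ltnP b n.-1.
  rewrite (addnAC a j i) addnA; case: eqP => E; last by rewrite !mul0r mulr0 subrr.
  rewrite !mul1r (subnAC _ j i) subnDA.
  have -> : (n - a - i)%:R = (n - a - i - j)%:R + j%:R :> K.
    by rewrite -natrD; congr _%:R; lia.
  have -> : (n - a - j)%:R = (n - a - i - j)%:R + i%:R :> K.
    by rewrite -natrD; congr _%:R; lia.
  ring.
rewrite (addnAC a j i) addnA; case: eqP => E; last by rewrite !mul0r mulr0 subrr.
(* Last column: the identity is [j (j - 1) - i (i - 1) = (j - i) (i + j - 1)]. *)
have -> : (n - a - i = j)%N by lia.
have -> : (n - a - j = i)%N by lia.
case: i j i0 j0 {E} => [//|i] [//|j] _ _ /=.
by rewrite natrD -!natr1; ring.
Qed.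

Lemma unscaled_phi_big i : (n < i)%N -> unscaled_phi i = 0.
Proof.
move=> ni; apply/matrixP => a b; rewrite !mxE; have := ltn_ord b => bn.
have -> : (b == a + i :> nat)%N = false by lia.
have -> : (a + i == n)%N = false by lia.
      by rewrite !mul0r if_same.
Qed.

End Phi.

(** * Homomorphism property and injectivity of [phi] *)

Section PhiRep.
Variables (K : numFieldType) (n : nat).

Lemma phi_gen_br i j : (0 < i)%N -> (0 < j)%N ->
  phi_gen K n i *m phi_gen K n j - phi_gen K n j *m phi_gen K n i =
  (j%:R - i%:R) *: phi_gen K n (i + j).
Proof.
move=> i0 j0; rewrite !phi_gen_diag ?addn_gt0 ?i0 //.
set D := diag_mx (fact_diag K n); set D' := diag_mx _.
have DD : D *m D' = 1%:M.
  apply/matrixP => a b; rewrite mul_diag_mx !mxE.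
  by case: eqP => [->|_]; rewrite ?mulr1n ?mulr0n ?mulr0 ?divff ?fact_natr_neq0.
have DDK (X Y : 'M[K]_n) : D' *m X *m D *m (D' *m Y *m D) = D' *m (X *m Y) *m D.
  by rewrite !mulmxA -(mulmxA _ D D') DD mulmx1.
rewrite !DDK -mulmxBl -mulmxBr unscaled_phi_br //.
by rewrite -scalemxAr -scalemxAl.
Qed.

Lemma phi_gen_big i : (n < i)%N -> phi_gen K n i = 0.
Proof.
move=> ni; rewrite phi_gen_diag; last by lia.
by rewrite unscaled_phi_big // mulmx0 mul0mx.
Qed.

Lemma phi_sumE (x : Witt K n) :
  phi K n x = \sum_(i < n) (x : 'rV[K]_n) 0 i *: phi_gen K n i.+1.
Proof. by rewrite lfunE. Qed.

Lemma phi_Witt_str i j : (0 < i)%N -> (0 < j)%N ->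
  phi K n (Witt_str K n i j) = (j%:R - i%:R) *: phi_gen K n (i + j).
Proof.
move=> i0 j0; rewrite /Witt_str; case: ifP => ij.
  by rewrite linearZ /= phiE // ij addn_gt0 i0.
by rewrite linear0 phi_gen_big ?scaler0 //; lia.
Qed.

Lemma phi_hom : lie_hom (phi K n).
Proof.
move=> x y.
change (phi K n (Witt_br x y) = phi K n x *m phi K n y - phi K n y *m phi K n x).
have mulE (u v : Witt K n) : phi K n u *m phi K n v =
    \sum_(i < n) \sum_(j < n) ((u : 'rV[K]_n) 0 i * (v : 'rV[K]_n) 0 j) *:
      (phi_gen K n i.+1 *m phi_gen K n j.+1).
  rewrite !phi_sumE mulmx_suml; apply: eq_bigr => i _.
  rewrite mulmx_sumr; apply: eq_bigr => j _.
  by rewrite -scalemxAl -scalemxAr scalerA.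
rewrite !mulE [X in _ = _ - X]exchange_big -sumrB linear_sum.
apply: eq_bigr => i _ /=; rewrite linear_sum -sumrB; apply: eq_bigr => j _ /=.
by rewrite linearZ /= phi_Witt_str // -phi_gen_br // mulrC scalerBr.
Qed.

(** The last column holds the coordinates along [e_2], ..., [e_n] in distinct rows, up to nonzero
    factors. The one along [e_1] is then read at the 0-based position [(0, 1)], which for [n >= 3]
    lies outside the last column. *)
Lemma phi_inj : (3 <= n)%N -> injective (phi K n).
Proof.
move=> n3; suff phi0 x : phi K n x = 0 -> x = 0.
  by move=> x y E; apply/subr0_eq/phi0; rewrite linearB /= E subrr.
move=> /matrixP E; apply/rowP => i; rewrite [RHS]mxE.
have last_col (a j : 'I_n) (b : 'I_n) : (b = n.-1 :> nat) ->
    phi_gen K n j.+1 a b = (a + j.+1 == n)%N%:R * (j%:R / j`!%:R).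
  by move=> bE; rewrite phi_genE // bE ltnn.
have x_pos (j : 'I_n) : (0 < j)%N -> (x : 'rV[K]_n) 0 j = 0.
  move=> j0; have an : (n - j.+1 < n)%N by lia.
  have bn : (n.-1 < n)%N by lia.
  have := E (Ordinal an) (Ordinal bn); rewrite phi_sumE summxE [RHS]mxE.
  rewrite (bigD1 j) //= big1 => [|k kj].
    rewrite mxE last_col // subnK ?ltn_ord // eqxx mul1r addr0 => /eqP.
    rewrite !mulf_eq0 invr_eq0 (negbTE (fact_natr_neq0 _ _)) pnatr_eq0.
    by rewrite (gtn_eqF j0) !orbF => /eqP.
  rewrite mxE last_col //=.
  have -> : (n - j.+1 + k.+1 == n)%N = false.
    apply/negbTE; apply: contra kj => /eqP kj; apply/eqP/val_inj => /=.
    by have := ltn_ord j; lia.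
  by rewrite mul0r mulr0.
have [i0|] := posnP i; last exact: x_pos.
have an : (0 < n)%N by lia.
have bn : (1 < n)%N by lia.
have := E (Ordinal an) (Ordinal bn); rewrite phi_sumE summxE [RHS]mxE.
rewrite (bigD1 i) //= big1 => [|k ki].
  rewrite mxE phi_genE //= i0 subn0.
  have -> : (1 < n.-1)%N by lia.
  by rewrite addr0 mul1r subn1 divff ?fact_natr_neq0 // mulr1.
rewrite x_pos ?scale0r ?mxE // lt0n -i0; apply: contra ki.
by move=> /eqP ki; apply/eqP/val_inj.
Qed.

End PhiRep.

(** * Filiformity *)

Section LowerCentral.
Variables (K : fieldType) (L : lieAlgType K).
Implicit Types U V W : {vspace L}.

Lemma lie_br0l (y : L) : lie_br 0 y = 0.
Proof. by have := lie_brPl (-1) 0 0 y; rewrite scaler0 addr0 scaleN1r addNr. Qed.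

Lemma lie_br0r (y : L) : lie_br y 0 = 0.
Proof. by have := lie_brPr (-1) 0 0 y; rewrite scaler0 addr0 scaleN1r addNr. Qed.

Lemma mem_lie_prodv U V u v : u \in U -> v \in V -> lie_br u v \in lie_prodv U V.
Proof.
move=> /coord_vbasis -> /coord_vbasis ->.
elim/big_rec: _ => [|i x _ IH]; first by rewrite lie_br0l mem0v.
rewrite lie_brPl rpredD ?rpredZ //.
elim/big_rec: _ => [|j y _ IHy]; first by rewrite lie_br0r mem0v.
rewrite lie_brPr rpredD ?rpredZ //; apply: memv_span.
by apply: allpairs_f; rewrite mem_nth ?size_tuple.
Qed.

Lemma lie_prodv_sub U V W :
  (forall u v, u \in U -> v \in V -> lie_br u v \in W) ->
  (lie_prodv U V <= W)%VS.
Proof.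
move=> UVW; apply/span_subvP => _ /allpairsP[[u v] [/= /vbasis_mem uU /vbasis_mem vV ->]].
exact: UVW.
Qed.

End LowerCentral.

Section WittFiliform.
Variables (K : numFieldType) (n : nat).

Definition Witt_tail (i : nat) : {vspace Witt K n} :=
  <<[seq We K n k | k <- iota i.+1 (n - i)]>>%VS.

Lemma dim_Witt_tail i : \dim (Witt_tail i) = (n - i)%N.
Proof.
have [ni|/ltnW ni] := leqP n i.
  by rewrite /Witt_tail (eqP ni) span_nil dimv0.
have iota_n : iota 1 n = iota 1 i ++ iota i.+1 (n - i).
  by rewrite -add1n -iotaD subnKC.
have /andP[_] := Witt_basis K n; rewrite iota_n map_cat => /catr_free.
by rewrite /free size_map size_iota => /eqP.
Qed.

Lemma We_tail i k : (i < k <= n)%N -> We K n k \in Witt_tail i.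
Proof.
by move=> ik; apply/memv_span/map_f; rewrite mem_iota; lia.
Qed.

Lemma Witt_tailP i (x : Witt K n) :
  reflect (forall j : 'I_n, (j < i)%N -> (x : 'rV[K]_n) 0 j = 0)
          (x \in Witt_tail i).
Proof.
apply: (iffP idP) => [|x0].
  rewrite /Witt_tail => /coord_span -> j ji.
  rewrite summxE big1 // => k _; rewrite mxE.
  rewrite (nth_map 0%N) ?size_iota // mxE nth_iota //.
  have -> : (j.+1 == i.+1 + k)%N = false by lia.
  by rewrite mulr0.
rewrite [x]Witt_coord; apply: memv_suml => j _.
have [ji|ij] := ltnP j i; first by rewrite x0 // scale0r mem0v.
by rewrite memvZ // We_tail // ltnS ij ltn_ord.
Qed.

Lemma lie_br_tail i (x y : Witt K n) :
  y \in Witt_tail i -> lie_br x y \in Witt_tail i.+1.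
Proof.
move=> /Witt_tailP y0; apply/Witt_tailP => j ji.
change ((Witt_br x y : 'rV[K]_n) 0 j = 0).
rewrite summxE big1 // => a _; rewrite summxE big1 // => b _.
rewrite mxE /Witt_str; have [bi|ib] := ltnP b i; first by rewrite y0 // mulr0 mul0r.
case: ifP => _; rewrite ?mxE; last by rewrite mulr0.
have -> : (j.+1 == a.+1 + b.+1)%N = false by lia.
by rewrite !mulr0.
Qed.

(** By degree, [e_2] could only come from [[e_1, e_1] = 0]. *)
Lemma lie_br_tail2 (x y : Witt K n) : lie_br x y \in Witt_tail 2.
Proof.
apply/Witt_tailP => j j2.
change ((Witt_br x y : 'rV[K]_n) 0 j = 0).
rewrite summxE big1 // => a _; rewrite summxE big1 // => b _.
rewrite mxE /Witt_str; case: ifP => _; rewrite ?mxE; last by rewrite mulr0.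
case: eqP => E; last by rewrite !mulr0.
have [-> ->] : a = 0%N :> nat /\ b = 0%N :> nat by lia.
by rewrite subrr mul0r mulr0.
Qed.

(** For [k >= 3], [e_k] is [[e_1, e_(k-1)]] divided by [k - 2], which is nonzero in characteristic
    zero. *)
Lemma Witt_tail_sub i (V : {vspace Witt K n}) : (2 <= i)%N ->
  (forall k, (i <= k <= n)%N -> We K n k \in V) ->
  (Witt_tail i <= lie_prodv fullv V)%VS.
Proof.
move=> i2 WV; apply/span_subvP => x /mapP[k + ->].
rewrite mem_iota => ik.
have k2 : (k.-1%:R - 1%:R : K) != 0 by rewrite -natrB ?pnatr_eq0; lia.
have -> : We K n k =
    (k.-1%:R - 1%:R)^-1 *: lie_br (We K n 1) (We K n k.-1).
  rewrite Witt_lie_br; try lia.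
  have -> : (1 + k.-1 = k)%N by lia.
  have -> : (k <= n)%N by lia.
  by rewrite scalerK.
by apply/memvZ/mem_lie_prodv; [exact: memvf | apply: WV; lia].
Qed.

(** The pattern starts at [L^2]: the whole algebra [L^1] also contains [e_1], while [Witt_tail 1]
    does not. *)
Lemma lower_central_Witt i :
  lower_central (Witt K n) i.+2 = Witt_tail i.+2.
Proof.
apply/eqP; rewrite eqEsubv; elim: i => [|i IH].
  apply/andP; split; last by apply: Witt_tail_sub => // k _; exact: memvf.
  by apply: lie_prodv_sub => u v _ _; exact: lie_br_tail2.
move: IH; rewrite -eqEsubv => /eqP IH.
have -> : lower_central (Witt K n) i.+3 =
    lie_prodv fullv (lower_central (Witt K n) i.+2) by [].
rewrite IH; apply/andP; split.
  by apply: lie_prodv_sub => u v _; exact: lie_br_tail.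
by apply: Witt_tail_sub => // k; exact: We_tail.
Qed.

Lemma Witt_filiform : filiform (Witt K n).
Proof.
move=> [|[|i]] // /andP[_ _].
by rewrite lower_central_Witt dim_Witt_tail dimvf /dim /= mul1n.
Qed.

End WittFiliform.

(** * Minimality *)

(** [We] is zero beyond [n], so composing it with [f] already gives the continuation by zero. *)
Lemma Witt_hom_family (K : numClosedFieldType) (n m : nat)
    (f : 'Hom(Witt K n, gl K m)) :
  lie_hom f -> @witt_family K n m (fun i => f (We K n i)).
Proof.
move=> fh.
have We0 i : (n < i)%N -> We K n i = 0.
  move=> ni; apply/rowP => j; rewrite !mxE.
  by have -> : (j.+1 == i)%N = false by have := ltn_ord j; lia.
split=> [i /We0 ->|i j i0 j0]; first exact: linear0.
change (lie_br (f (We K n i)) (f (We K n j)) = (j%:R - i%:R) *: f (We K n (i + j))).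
rewrite -fh -linearZ /=; congr (f _).
have [ni|ni] := ltnP n i.
  by rewrite (We0 i) // (We0 (i + j)%N) ?lie_br0l ?scaler0 //; lia.
have [nj|nj] := ltnP n j.
  by rewrite (We0 j) // (We0 (i + j)%N) ?lie_br0r ?scaler0 //; lia.
rewrite Witt_lie_br ?i0 ?j0 //; case: ifP => // ij.
by rewrite We0 ?scaler0 //; lia.
Qed.

Lemma Witt_faithful_dim (K : numClosedFieldType) (n m : nat) : (3 <= n)%N ->
  is_faithful_dim (Witt K n) m -> (n <= m)%N.
Proof.
move=> n3 [f [fh fi]]; rewrite leqNgt; apply/negP => mn.
have := witt_family_last0 (Witt_hom_family fh) n3 mn.
(* Injectivity would give [e_n = 0], but its 0-based coordinate [n.-1] is 1. *)
rewrite -(linear0 f) => /fi /rowP /(_ (Ordinal (_ : n.-1 < n)%N)) H.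
have n1 : (n.-1 < n)%N by lia.
have := H n1; rewrite !mxE /= prednK; last by lia.
by rewrite eqxx => /eqP; rewrite oner_eq0.
Qed.

Theorem proposition4 (R : realType) (n : nat) (hn : (3 <= n)%N) :
  [/\ \dim {:Witt R[i] n} = n,
      filiform (Witt R[i] n),
      lie_hom (phi R[i] n) /\ injective (phi R[i] n),
      lie_subalgebra (limg (phi R[i] n)) &
      minimal_rep (phi R[i] n)].
Proof.
have faithful : faithful_rep (phi R[i] n).
  by split; [exact: phi_hom | exact: phi_inj].
have [ph pj] := faithful.
have dim_n : is_faithful_dim (Witt R[i] n) n by exists (phi R[i] n).
have dim_ge k : is_faithful_dim (Witt R[i] n) k -> (n <= k)%N.
  exact: Witt_faithful_dim.
split.
- by rewrite dimvf /dim /= mul1n.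
- exact: Witt_filiform.
- by [].
- by move=> _ _ /memv_imgP[x _ ->] /memv_imgP[y _ ->]; rewrite -ph memv_img ?memvf.
(* The default value of [xget] is excluded because [n] itself belongs to the set. *)
- split=> //; rewrite /mu; case: xgetP => [m _ [mf mle]|/(_ n)]; last by case.
  by apply/eqP; rewrite eqn_leq dim_ge // mle.
Qed.
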